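(* Let $S\in\mathcal{I}_1\cap\mathcal{I}_2$ be such that the shortest $s$–$t$ path in $G(S)$ has length $2(\ell+1)$. If $\mathcal{P}=(p_1,\dots,p_k)$ is an ordered collection of consecutive shortest augmenting paths in $G(S)$, then there is (and one can construct from $\mathcal{P}$) an augmenting set $\Pi_\ell$ in $G(S)$ of width $|\mathcal{P}|=k$.
   Context: $\mathcal{M}_1=(V,\mathcal{I}_1)$, $\mathcal{M}_2=(V,\mathcal{I}_2)$ are matroids. For $S\in\mathcal{I}_1\cap\mathcal{I}_2$, the exchange graph $G(S)$ is the directed graph on $V\cup\{s,t\}$ with arcs: $(s,a)$ for $a\notin S$ with $S+a\in\mathcal{I}_1$; $(a,t)$ for $a\notin S$ with $S+a\in\mathcal{I}_2$; $(a,b)$ for $a\in S$, $b\notin S$ with $S-a+b\in\mathcal{I}_1$; $(b,a)$ for $a\in S$, $b\notin S$ with $S-a+b\in\mathcal{I}_2$. Augmenting $S$ along a path $s,v_1,\dots,v_a,t$ replaces $S$ by $S+v_1-v_2+\cdots-v_{a-1}+v_a$. An ordered collection $(p_1,\dots,p_k)$ is a collection of consecutive shortest augmenting paths in $G(S)$ if each $p_i$ is an $s$–$t$ path of length $2(\ell+1)$ and $p_i$ is a path in $G(S_i)$, where $S_1=S$ and $S_i$ is obtained from $S$ by augmenting along $p_1,\dots,p_{i-1}$ in order. $D_i$ is the set of elements of $V$ at distance exactly $i$ from $s$ in $G(S)$. An augmenting set in $G(S)$ is a sequence $(B_1,A_1,\dots,A_\ell,B_{\ell+1})$ with: (a) $A_k\subseteq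 D_{2k}$, $B_k\subseteq D_{2k-1}$; (b) all sets have the same size $w$ (the width); (c) $S+B_1\in\mathcal{I}_1$; (d) $S+B_{\ell+1}\in\mathcal{I}_2$; (e) $S-A_k+B_{k+1}\in\mathcal{I}_1$ for $1\le k\le\ell$; (f) $S-A_k+B_k\in\mathcal{I}_2$ for $1\le k\le\ell$. *)

(* Defs.v *)
From mathcomp Require Import all_boot.

Set Implicit Arguments.
Unset Strict Implicit.
Unset Printing Implicit Defensive.

Record matroid (V : finType) := Matroid {
  indep :> {set {set V}};
  indep0 : set0 \in indep;
  indepS : forall X Y : {set V}, X \subset Y -> Y \in indep -> X \in indep;
  indep_exchange : forall X Y : {set V},
    X \in indep -> Y \in indep -> #|X| < #|Y| ->
    exists2 y, y \in Y :\: X & y |: X \in indep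
}.

(* [inl v] is the element v; the two elements of [bool] serve as s and t. *)
Notation vertex V := (V + bool)%type.
Notation src := (inr false).
Notation snk := (inr true).

Section Digraph.
Variables (T : finType) (e : rel T).

Definition has_walk (x y : T) (n : nat) : bool :=
  [exists p : n.-tuple T, path e x p && (last x p == y)].

Definition dist_is (x y : T) (n : nat) : bool :=
  has_walk x y n && [forall m : 'I_n, ~~ has_walk x y m].

End Digraph.

Section MatroidIntersection.
Variables (V : finType) (M1 M2 : matroid V).
Implicit Types (S : {set V}) (p : seq V) (P : seq (seq V)).

Definition exchange_graph S : rel (vertex V) := fun x y =>
  match x, y with
  | src, inl a => (a \notin S) && (a |: S \in indep M1)
  | inl a, snk => (a \notin S) && (a |: S \in indep M2)
  | inl a, inl b =>
         [&& a \in S, b \notin S & b |: (S :\ a) \in indep M1]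
      || [&& a \notin S, b \in S & a |: (S :\ b) \in indep M2]
  | _, _ => false
  end.

(* No arc enters s or leaves t, so an s-t path s, v_1, ..., v_a, t is given by
   the list [:: v_1; ...; v_a] of its interior vertices, all in V. *)
Definition is_st_path S p : bool :=
  path (exchange_graph S) src (rcons (map inl p) snk) && uniq p.

Definition st_length p : nat := (size p).+1.

(* S + v_1 - v_2 + ... - v_{a-1} + v_a, read from left to right *)
Fixpoint augment S p : {set V} :=
  match p with
  | [::] => S
  | [:: v] => v |: S
  | v :: w :: q => augment ((v |: S) :\ w) q
  end.

(* The i-th list of P, counted from 0, is p_{i+1}; it must be a path in
   G(S_{i+1}), and S_{i+1} is [foldl augment S (take i P)]. *)
Definition consecutive_shortest_paths (l : nat) S P : Prop :=
  forall i, i < size P ->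
    st_length (nth [::] P i) = 2 * l.+1 /\
    is_st_path (foldl augment S (take i P)) (nth [::] P i).

Definition layer S (i : nat) : {set V} :=
  [set v | dist_is (exchange_graph S) src (inl v) i].

(* The sequence (B_1, A_1, ..., A_l, B_{l+1}) is the pair of
   (B_1, ..., B_{l+1}) and (A_1, ..., A_l). Tuples count from 0, so for
   k : 'I_l the sets A_{k+1}, B_{k+1}, B_{k+2} are [tnth A k],
   [tnth B (widen_ord (leqnSn l) k)] and [tnth B (lift ord0 k)]. *)
Definition set_chain (l : nat) : Type :=
  (l.+1.-tuple {set V} * l.-tuple {set V})%type.

Definition is_augmenting_set (l : nat) S (w : nat) (Pi : set_chain l) : bool :=
  let: (B, A) := Pi in
  [&& [forall k : 'I_l, tnth A k \subset layer S (2 * k.+1)],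
      [forall k : 'I_l.+1, tnth B k \subset layer S (2 * k.+1 - 1)],
      [forall k : 'I_l, #|tnth A k| == w],
      [forall k : 'I_l.+1, #|tnth B k| == w],
      S :|: tnth B ord0 \in indep M1,
      S :|: tnth B ord_max \in indep M2,
      [forall k : 'I_l,
        (S :\: tnth A k) :|: tnth B (lift ord0 k) \in indep M1]
    & [forall k : 'I_l,
        (S :\: tnth A k) :|: tnth B (widen_ord (leqnSn l) k) \in indep M2]].

End MatroidIntersection.

(* Main.v *)
Require Import Defs.
From mathcomp Require Import all_boot.
From mathcomp Require Import zify.

(* Let d be the distance from s in G(S), capped at N = 2(l+1), and group the
   distances in pairs: {2k, 2k+1} for the first matroid, {N-2k, N-2k-1} for the
   second. For each matroid the absence of arcs that jump over a distance means
   that S meets every final segment of levels in a basis of it. A set T with the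
   same number of elements as S in each level above level 0 is then independent
   if and only if, for every single level, exchanging S for T in that level only
   gives an independent set.
   Applied to S_i and S_(i+1), this shows that augmenting keeps independence and
   that the arcs of G(S_(i+1)) still do not jump over a distance of G(S), so
   that every p_i visits distances 1, ..., N-1 once each, in order. Applied to S and
   the final set T, it says that the elements added and removed at each distance
   form an augmenting set. *)

Set Implicit Arguments.
Unset Strict Implicit.
Unset Printing Implicit Defensive.

(** * Independent sets in a matroid whose elements are ranked by [g] *)

Section Levels.
Variables (V : finType) (M : matroid V).
Implicit Types (S T U X Y Z : {set V}).

Lemma indep_extend X Y : X \in indep M -> Y \in indep M -> #|X| <= #|Y| ->
  exists Z, [/\ X \subset Z, Z \subset X :|: Y, Z \in indep M & #|Z| = #|Y|].
Proof.
move=> + iY; move En: (#|Y| - #|X|) => n.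
elim: n X En => [|n IHn] X En iX leXY.
  exists X; split=> //; [exact: subsetUl | lia].
have [|y /setDP[yY yX] iyX] := indep_exchange iX iY.
  by move: En; clear; lia.
have cyX : #|y |: X| = #|X|.+1 by rewrite cardsU1 yX.
have [||Z [sZ Zs iZ cZ]] := IHn (y |: X) _ iyX;
  rewrite ?cyX; try by move: En leXY; clear; lia.
exists Z; split=> //; first exact: subset_trans (subsetUr _ _) sZ.
apply: subset_trans Zs _; rewrite -setUA subUset subxx andbT sub1set.
by rewrite !inE yY orbT.
Qed.

(** For independent [S] this says that [S :&: U] is a basis of [U], phrased without a rank
    function. *)
Definition spans U S :=
  forall Y, Y \in indep M -> Y \subset U -> #|Y| <= #|S :&: U|.

(** Enlarge [S :&: U] by elements of [T] to size [#|T|]. Nothing can be gained inside [U], so by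
    counting the enlarged set contains all of [T :\: U]. *)
Lemma span_swap U S T : S \in indep M -> T \in indep M ->
  spans U S -> spans U T -> (S :&: U) :|: (T :\: U) \in indep M.
Proof.
move=> iS iT spS spT.
have iSU : S :&: U \in indep M by apply: indepS iS; apply: subsetIl.
have leST : #|S :&: U| <= #|T :&: U| by apply: spT => //; apply: subsetIr.
have cT := cardsID U T.
have [|Z [sZ Zs iZ cZ]] := indep_extend iSU iT.
  by rewrite -cT (leq_trans leST) ?leq_addr.
have iZU : Z :&: U \in indep M by apply: indepS iZ; apply: subsetIl.
have cZU := spS _ iZU (subsetIr _ _).
have cZID := cardsID U Z.
have sZD : Z :\: U \subset T :\: U.
  apply/subsetP=> x /setDP[xZ xU]; have := subsetP Zs x xZ.
  by rewrite !inE (negPf xU) andbF.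
have eZD : Z :\: U = T :\: U.
  apply/eqP; rewrite eqEcard sZD /=.
  by move: leST cT cZU cZID cZ; clear; lia.
apply: indepS iZ; rewrite subUset sZ -eZD; exact: subsetDl.
Qed.

Variable g : V -> nat.

Definition upper k := [set v | k <= g v].
Definition level k := [set v | g v == k].

Lemma upperS k : upper k = level k :|: upper k.+1.
Proof. by apply/setP=> x; rewrite !inE leq_eqVlt eq_sym. Qed.

Definition level_spanning S := forall k, 0 < k -> spans (upper k) S.

Definition level_monotone S :=
  (forall a b, a \in S -> b \notin S -> b |: (S :\ a) \in indep M -> g b <= g a)
  /\ (forall b, b \notin S -> b |: S \in indep M -> g b = 0).

(** Otherwise some [y] in [upper k] extends [S :&: upper k]. Enlarging further by elements of [S] to
    size [#|S|] gives [y |: (S :\ a)] with [g a < k], an exchange that raises [g]. *)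
Lemma level_monotone_spanning S :
  S \in indep M -> level_monotone S -> level_spanning S.
Proof.
move=> iS [mono0 mono1] k k0 Y iY sYU; rewrite leqNgt; apply/negP=> ltY.
have iSU : S :&: upper k \in indep M by apply: indepS iS; apply: subsetIl.
have [y /setDP[yY yS] iyS] := indep_exchange iSU iY ltY.
have yU := subsetP sYU y yY.
have {}yS : y \notin S by move: yS; rewrite inE yU andbT.
rewrite inE in yU.
have cy : #|y |: (S :&: upper k)| = #|S :&: upper k|.+1.
  by rewrite cardsU1 inE (negPf yS).
have cS := cardsID (upper k) S.
(* If the extension is already larger than [S], then [S] lies inside [upper k], and [y] can be added
   to [S] although [g y] is positive. *)
have [le|gt] := leqP #|y |: (S :&: upper k)| #|S|; last first.
  have /eqP e : #|S :\: upper k| == 0 by move: cS cy gt; clear; lia.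
  move/eqP: e; rewrite cards_eq0 setD_eq0 => /setIidPl e.
  by rewrite e in iyS; rewrite (mono1 y yS iyS) leqNgt k0 in yU.
have [Z [sZ Zs iZ cZ]] := indep_extend iyS iS le.
have yZ : y \in Z by apply: (subsetP sZ); rewrite setU11.
have sZS : Z \subset y |: S.
  apply: subset_trans Zs _; rewrite subUset subsetUr andbT.
  by apply: setUS; apply: subsetIl.
have [a aS aZ] : exists2 a, a \in S & a \notin Z.
  apply/subsetPn; apply/negP=> sSZ.
  have := subset_leq_card (_ : y |: S \subset Z).
  by rewrite cardsU1 yS cZ add1n ltnn subUset sub1set yZ sSZ => /(_ isT).
have ga : g a < k.
  rewrite ltnNge; apply: contra aZ => ga; apply: (subsetP sZ).
  by rewrite !inE aS ga orbT.
have ya : y != a by apply: contraNneq yS => ->.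
have eZ : Z = y |: (S :\ a).
  apply/eqP; rewrite eqEcard; apply/andP; split.
    apply/subsetP=> x xZ; have := subsetP sZS x xZ; rewrite !inE.
    by case: eqP => //= _ ->; rewrite andbT; apply: contraNneq aZ => <-.
  by rewrite cardsU1 !inE (negPf yS) andbF cZ (cardsD1 a S) aS.
rewrite eZ in iZ; have := leq_trans yU (mono0 a y aS yS iZ).
by rewrite leqNgt ga.
Qed.

(** A violating [b] could be added to the part of [S] strictly above the level of [a], or above
    level 0 when nothing is removed, against maximality there. *)
Lemma level_spanning_monotone S : level_spanning S -> level_monotone S.
Proof.
move=> spS.
have key k b X : 0 < k -> b \notin S -> k <= g b ->
    S :&: upper k \subset X -> b |: X \notin indep M.
  move=> k0 bS gb sX; apply/negP=> iX.
  have iY : b |: (S :&: upper k) \in indep M by apply: indepS iX; apply: setUS.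
  have := spS k k0 _ iY.
  rewrite cardsU1 inE (negPf bS) subUset subsetIr sub1set inE gb => /(_ isT).
  lia.
split=> [a b aS bS|b bS] ib.
  rewrite leqNgt; apply/negP=> lt; move: ib; apply/negP.
  apply: (key (g a).+1) => //; apply/subsetP=> x; rewrite !inE => /andP[-> gx].
  by rewrite andbT; apply: contraTneq gx => ->; rewrite ltnn.
apply/eqP; rewrite -leqn0 leqNgt; apply/negP=> lt; move: ib; apply/negP.
by apply: (key 1) => //; apply: subsetIl.
Qed.

Lemma level_card_spanning S T : level_spanning S ->
  (forall k, 0 < k -> #|T :&: level k| = #|S :&: level k|) -> level_spanning T.
Proof.
move=> spS eqc k k0 Y iY sY; suff -> : #|T :&: upper k| = #|S :&: upper k|.
  exact: spS.
have cU X j : #|X :&: upper j| = #|X :&: level j| + #|X :&: upper j.+1|.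
  rewrite [in LHS]upperS setIUr cardsU -setIIr.
  suff -> : level j :&: upper j.+1 = set0 by rewrite setI0 cards0 subn0.
  by apply/setP=> x; rewrite !inE; case: eqP => //= ->; rewrite ltnn.
(* Downward induction on [k], starting past the maximum of [g], where [upper k] is empty. *)
have [n] := ubnP ((\max_v g v).+1 - k).
elim: n k k0 {Y iY sY} => // n IHn k k0 ltn.
have [le|gt] := leqP k (\max_v g v).
  by rewrite (cU T) (cU S) eqc // IHn //; move: ltn le; clear; lia.
suff e : upper k = set0 by rewrite e !setI0.
apply/setP=> x; rewrite !inE; apply/negbTE; rewrite -ltnNge.
exact: leq_ltn_trans (leq_bigmax x) gt.
Qed.

Definition level_swap S T k := (S :\: level k) :|: (T :&: level k).

Lemma eq_spans U S T : S :&: U = T :&: U -> spans U S -> spans U T.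
Proof. by rewrite /spans => ->. Qed.

(** Two gluings: first [T] from level [k] upwards with [S] below, then [S] strictly above level [k]
    with the result of the first. *)
Lemma level_swap_indep S T k : S \in indep M -> T \in indep M ->
  level_spanning S -> level_spanning T -> level_swap S T k \in indep M.
Proof.
move=> iS iT spS spT.
have iX : (T :&: upper k) :|: (S :\: upper k) \in indep M.
  have [-> | k0] := posnP k; last exact: span_swap (spT k k0) (spS k k0).
  apply: indepS iT; apply/subsetP=> x; rewrite !inE /= andbT; by case/orP.
have spX : spans (upper k.+1) ((T :&: upper k) :|: (S :\: upper k)).
  apply: eq_spans (spT k.+1 isT); apply/setP=> x; rewrite !inE.
  by case: (ltngtP k (g x)); rewrite ?andbT ?andbF ?orbF.
have := span_swap iS iX (spS k.+1 isT) spX; apply: indepS.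
apply/subsetP=> x; rewrite !inE.
by case: (ltngtP k (g x)); rewrite ?andbT ?andbF ?orbF.
Qed.

(** The levels are replaced from the top down: [T] above [k] with [S] elsewhere is glued to the
    single swap at [k], since both contain a basis of [upper k.+1]. *)
Lemma indep_level_swap S T : S \in indep M ->
  level_spanning S -> level_spanning T ->
  (forall k, level_swap S T k \in indep M) -> T \in indep M.
Proof.
move=> iS spS spT iE.
suff iX k : (T :&: upper k) :|: (S :\: upper k) \in indep M.
  by apply: indepS (iX 0); apply/subsetP=> x; rewrite !inE /= andbT => ->.
have [n] := ubnP ((\max_v g v).+1 - k).
elim: n k => // n IHn k ltn.
have [le|gt] := leqP k (\max_v g v); last first.
  apply: indepS iS; apply/subsetP=> x; rewrite !inE => /orP[/andP[_ kx]|].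
    by have := leq_trans gt (leq_trans kx (leq_bigmax x)); rewrite ltnn.
  by case/andP.
have {}IHn : (T :&: upper k.+1) :|: (S :\: upper k.+1) \in indep M.
  by apply: IHn; move: ltn le; clear; lia.
set X := _ :|: _ in IHn.
have spX : spans (upper k.+1) X.
  apply: eq_spans (spT k.+1 isT); apply/setP=> x; rewrite !inE.
  by case: (ltngtP k (g x)); rewrite ?andbT ?andbF ?orbF.
have spE : spans (upper k.+1) (level_swap S T k).
  apply: eq_spans (spS k.+1 isT); apply/setP=> x; rewrite !inE.
  by case: (ltngtP k (g x)); rewrite ?andbT ?andbF ?orbF.
have := span_swap IHn (iE k) spX spE; apply: indepS.
apply/subsetP=> x; rewrite !inE.
by case: (ltngtP k (g x)); rewrite ?andbT ?andbF ?orbF.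
Qed.

End Levels.

(** * Distances truncated at a bound [N] *)

Section CappedDistance.
Variables (T : finType) (e : rel T).

Lemma has_walk_step x y z n : has_walk e x y n -> e y z -> has_walk e x z n.+1.
Proof.
case/existsP=> p /andP[ep /eqP ly] eyz; apply/existsP.
by exists [tuple of rcons p z]; rewrite rcons_path ep ly eyz last_rcons eqxx.
Qed.

(** When no walk is shorter than [N], [find] returns the length [N] of the list, which provides the
    cap. *)
Definition capped_dist N x y := find (has_walk e x y) (iota 0 N).

Lemma capped_dist_le N x y : capped_dist N x y <= N.
Proof. by rewrite -[leqRHS](size_iota 0); apply: find_size. Qed.

Lemma capped_dist_le_walk N x y n : has_walk e x y n -> capped_dist N x y <= n.
Proof.
move=> w; rewrite leqNgt; apply/negP=> lt.
have := before_find 0 lt; rewrite nth_iota ?w //.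
exact: leq_trans lt (capped_dist_le _ _ _).
Qed.

Lemma capped_distP N x y :
  capped_dist N x y < N -> dist_is e x y (capped_dist N x y).
Proof.
set d := capped_dist N x y => lt; apply/andP; split.
  have := nth_find 0 (_ : has (has_walk e x y) (iota 0 N)).
  by rewrite has_find size_iota -/(capped_dist N x y) nth_iota // add0n; apply.
apply/forallP=> m; apply/negP=> /(@capped_dist_le_walk N).
by rewrite leqNgt ltn_ord.
Qed.

Lemma capped_dist_cap N x y : dist_is e x y N -> capped_dist N x y = N.
Proof.
case/andP=> _ /forallP nw; apply/eqP; rewrite eqn_leq capped_dist_le leqNgt.
apply/negP=> lt; have /andP[w _] := capped_distP lt.
by have := nw (Ordinal lt); rewrite w.
Qed.

Lemma capped_dist_step N x y z :
  e y z -> capped_dist N x z <= (capped_dist N x y).+1.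
Proof.
move=> eyz; have [lt|ge] := ltnP (capped_dist N x y) N.
  have /andP[w _] := capped_distP lt.
  exact: capped_dist_le_walk (has_walk_step w eyz).
by apply: leq_trans (capped_dist_le _ _ _) (leq_trans ge _).
Qed.

End CappedDistance.

(** The arcs out of s lead outside [S], and every arc between elements crosses between [S] and its
    complement. *)
Lemma exchange_walk_parity (V : finType) (M1 M2 : matroid V) (S : {set V}) v n :
  has_walk (exchange_graph M1 M2 S) src (inl v) n -> (v \in S) = ~~ odd n.
Proof.
case/existsP=> -[p /= /eqP <-] /andP[ep /eqP lp].
(* Induction on prefixes needs a claim for every endpoint: s ends only the empty walk, and t has no
   outgoing arc. *)
suff: match last src p with
      | inl v => (v \in S) = ~~ odd (size p)
      | inr false => p = [::]
      | inr true => True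
      end by rewrite lp.
elim/last_ind: p {v lp} ep => // p y IHp.
rewrite rcons_path last_rcons size_rcons => /andP[/IHp].
case: (last _ p) => [u|[]] //=; case: y => [v|[]] //=.
  by move=> <- /orP[] /and3P[uS vS _]; rewrite ?uS ?vS ?(negPf uS) ?(negPf vS).
by move=> -> /= /andP[/negPf-> _].
Qed.

(** * Augmentation as a symmetric difference *)

Section Augmentation.
Variable V : finType.
Implicit Types (T : {set V}) (p : seq V).

(** Since [p] alternates between the outside and the inside of [T], each addition or removal toggles
    membership. As [p] has no repetition, the rest still alternates after two steps. *)
Lemma augment_in x0 T p x : uniq p ->
    (forall j, j < size p -> (nth x0 p j \in T) = odd j) ->
  (x \in augment T p) = (x \in T) (+) (x \in p).
Proof.
have [n] := ubnP (size p); elim: n T p => // n IHn T [|v [|w q]] /= ltn.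
- by move=> _ _; rewrite addbF.
- move=> _ /(_ 0 isT) /= vT; rewrite !inE.
  by case: eqP => [->|_]; rewrite ?vT //= addbF.
case/and3P; rewrite inE negb_or => /andP[vw vq] wq uq alt.
have vT := alt 0 isT; have wT := alt 1 isT; rewrite /= in vT wT.
rewrite IHn //; last 2 first.
- by move: ltn; clear; lia.
- move=> j ltj; have mj := mem_nth x0 ltj.
  rewrite !inE; have /= := alt j.+2; rewrite negbK => <- //.
  case: eqP mj => [->|_ mj]; first by rewrite (negPf wq).
  by case: eqP mj => [->|_ //]; rewrite (negPf vq).
rewrite !inE; case: (x =P v) => [->|_]; first by rewrite vw vT (negPf vq).
by case: (x =P w) => [->|_]; rewrite ?wT ?(negPf wq).
Qed.

End Augmentation.

(** * Sets whose exchange graph respects the distances of G(S) *)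

Section Potential.
Variables (V : finType) (M1 M2 : matroid V) (S : {set V}) (l : nat).
Variable d : V -> nat.
Implicit Types (T : {set V}) (p : seq V).
Let N := 2 * l.+1.

Definition potential (x : vertex V) :=
  match x with inl v => d v | src => 0 | snk => N end.

Definition slow T := forall x y,
  exchange_graph M1 M2 T x y -> potential y <= (potential x).+1.

(** An [M1] arc leaves an [a] in [S], where [d a] is even, so [d b <= (d a).+1] amounts to
    [g1 b <= g1 a]. An [M2] arc enters [S], so [g2] measures back from [N]. *)
Let g1 v := (d v)./2.
Let g2 v := (N - d v)./2.

Hypothesis iS1 : S \in indep M1.
Hypothesis iS2 : S \in indep M2.
Hypothesis d_gt0 : forall v, 0 < d v.
Hypothesis d_le : forall v, d v <= N.
Hypothesis d_in : forall v, v \in S -> ~~ odd (d v).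
Hypothesis slowS : slow S.

(** If halves do not increase along an arc, the values themselves rise by at most one, whatever
    their parity. *)
Lemma slow_of_monotone T :
  level_monotone M1 g1 T -> level_monotone M2 g2 T -> slow T.
Proof.
move=> [m1 n1] [m2 n2] [a|[]] // [b|[]] //=.
- case/orP=> /and3P[aT bT iT].
    by have := m1 a b aT bT iT; rewrite /g1; clear; lia.
  have := m2 b a bT aT iT; have := d_le a; have := d_le b.
  by rewrite /g2; clear; lia.
- case/andP=> aT iT; have := n2 a aT iT; have := d_le a.
  by rewrite /g2; clear; lia.
- by case/andP=> bT iT; have := n1 b bT iT; rewrite /g1; clear; lia.
Qed.

Lemma monotoneS1 : level_monotone M1 g1 S.
Proof.
split=> [a b aS bS iS|b bS iS].
  have /= := @slowS (inl a) (inl b); rewrite aS bS iS => /(_ isT).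
  by have := d_in aS; rewrite /g1; clear; lia.
have /= := @slowS src (inl b); rewrite bS iS => /(_ isT).
by rewrite /g1; clear; lia.
Qed.

Lemma monotoneS2 : level_monotone M2 g2 S.
Proof.
split=> [a b aS bS iS|b bS iS].
  have /= := @slowS (inl b) (inl a); rewrite aS bS iS orbT => /(_ isT).
  by have := d_in aS; rewrite /g2 /N; clear; lia.
have /= := @slowS (inl b) snk; rewrite bS iS => /(_ isT).
by rewrite /g2; clear; lia.
Qed.

(* Invariant of T obtained from S by augmenting along i paths. *)
Record balanced T i := Balanced {
  bal_odd : forall j, j < N -> odd j -> #|T :&: level d j| = i;
  bal_even : forall j, 0 < j < N -> ~~ odd j -> #|(S :\: T) :&: level d j| = i;
  bal_sub : forall x, ~~ odd (d x) -> x \in T -> x \in S;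
  bal_cap : forall x, d x = N -> x \in S -> x \in T
}.

Lemma balancedS : balanced S 0.
Proof.
split=> // j _ oj; last by rewrite setDv set0I cards0.
apply: eq_card0 => x; rewrite !inE; apply/negP=> /andP[xS /eqP dx].
by have := d_in xS; rewrite dx oj.
Qed.

(** The [i] elements of [S] lost at the even distance are offset by the [i] gained at the odd one,
    where [S] has none. *)
Lemma balanced_pair T i (L : {set V}) ev od : balanced T i ->
    0 < ev < N -> od < N -> ~~ odd ev -> odd od ->
    (forall x, (x \in L) = (d x == ev) || (d x == od)) ->
  #|T :&: L| = #|S :&: L|.
Proof.
move=> [bo be bs _] ltev ltod eev ood inL.
have cL X : #|X :&: L| = #|X :&: level d ev| + #|X :&: level d od|.
  rewrite -cardsUI -setIIr -setIUr.
  have -> : level d ev :|: level d od = L by apply/setP=> x; rewrite !inE inL.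
  suff -> : level d ev :&: level d od = set0 by rewrite setI0 cards0 addn0.
  apply/setP=> x; rewrite !inE; apply/negP=> /andP[/eqP-> /eqP e].
  by rewrite -e (negPf eev) in ood.
rewrite !cL (bo od) //.
have -> : #|S :&: level d od| = 0.
  apply: eq_card0 => x; rewrite !inE; apply/negP=> /andP[xS /eqP dx].
  by have := d_in xS; rewrite dx ood.
rewrite addn0 -(be ev) // -(cardsID T (S :&: level d ev)); congr (_ + _).
  apply: eq_card => x; rewrite !inE; case: eqP => dx; rewrite ?andbF ?andbT //=.
  have edx : ~~ odd (d x) by rewrite dx.
  have := bs x edx. by case: (x \in T) (x \in S) => [] [] // ->.
by apply: eq_card => x; rewrite !inE -andbA.
Qed.

Lemma balanced_card1 T i k : balanced T i -> 0 < k ->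
  #|T :&: level g1 k| = #|S :&: level g1 k|.
Proof.
move=> bT k0; have [le|gt] := leqP k l.
  apply: (balanced_pair (ev := k.*2) (od := k.*2.+1) bT).
  - by move: k0 le; rewrite /N; clear; lia.
  - by move: k0 le; rewrite /N; clear; lia.
  - by clear; lia.
  - by clear; lia.
  - by move=> x; rewrite inE /g1; clear; lia.
(* For [k > l] only distance [N] can occur, and there [T] and [S] agree. *)
have [_ _ bs bc] := bT.
apply: eq_card => x; rewrite !inE; case: eqP; rewrite ?andbF // !andbT.
rewrite /g1 => dx.
have {}dx : d x = N by move: (d_le x) dx gt; rewrite /N; clear; lia.
by apply/idP/idP; [apply: bs; rewrite dx /N; clear; lia | apply: bc].
Qed.

Lemma balanced_card2 T i k : balanced T i -> 0 < k ->
  #|T :&: level g2 k| = #|S :&: level g2 k|.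
Proof.
move=> bT k0; have [le|gt] := leqP k l.
  apply: (balanced_pair (ev := N - k.*2) (od := (N - k.*2).-1) bT).
  - by move: k0 le; rewrite /N; clear; lia.
  - by move: k0 le; rewrite /N; clear; lia.
  - by move: k0 le; rewrite /N; clear; lia.
  - by move: k0 le; rewrite /N; clear; lia.
  - move=> x; rewrite inE; move: (d_le x) k0 le; rewrite /g2 /N; clear; lia.
(* For [k > l] the distance would have to be 0. *)
suff -> : level g2 k = set0 by rewrite !setI0.
apply/setP=> x; rewrite !inE; apply/eqP; move: (d_gt0 x) gt.
by rewrite /g2 /N; clear; lia.
Qed.

Lemma balanced_spanning1 T i : balanced T i -> level_spanning M1 g1 T.
Proof.
move=> bT; apply: (level_card_spanning (S := S)).
  exact: level_monotone_spanning monotoneS1.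
by move=> k; apply: balanced_card1 bT.
Qed.

Lemma balanced_spanning2 T i : balanced T i -> level_spanning M2 g2 T.
Proof.
move=> bT; apply: (level_card_spanning (S := S)).
  exact: level_monotone_spanning monotoneS2.
by move=> k; apply: balanced_card2 bT.
Qed.

Lemma balanced_slow T i : balanced T i -> slow T.
Proof.
move=> bT; apply: slow_of_monotone; apply: level_spanning_monotone.
  exact: balanced_spanning1 bT.
exact: balanced_spanning2 bT.
Qed.

(** * Augmenting a balanced set along one path *)

Section OnePath.
Variables (T : {set V}) (i : nat) (p : seq V) (x0 : V).
Hypothesis iT1 : T \in indep M1.
Hypothesis iT2 : T \in indep M2.
Hypothesis bT : balanced T i.
Hypothesis size_p : size p = (2 * l).+1.
Hypothesis st_p : is_st_path M1 M2 T p.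

Let uniq_p : uniq p.
Proof. by case/andP: st_p. Qed.

Let arc_src : exchange_graph M1 M2 T src (inl (nth x0 p 0)).
Proof.
case/andP: st_p => /(pathP snk) /(_ 0) + _.
rewrite size_rcons /= nth_rcons size_map size_p /=.
by rewrite (nth_map x0) ?size_p //; apply.
Qed.

Let arc_mid j : j.+1 < size p ->
  exchange_graph M1 M2 T (inl (nth x0 p j)) (inl (nth x0 p j.+1)).
Proof.
move=> ltj; case/andP: st_p => /(pathP snk) /(_ j.+1) + _.
rewrite size_rcons size_map /= !nth_rcons size_map ltj (ltnW ltj).
by rewrite !(nth_map x0) // ?(ltnW ltj) //; apply; apply: ltnW.
Qed.

Let arc_snk : exchange_graph M1 M2 T (inl (nth x0 p (2 * l))) snk.
Proof.
case/andP: st_p => /(pathP snk) /(_ (size p)) + _.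
rewrite size_rcons size_map size_p /= !nth_rcons size_map size_p.
by rewrite ltnS leqnn ltnn eqxx (nth_map x0) ?size_p //; apply.
Qed.

(** The [N] arcs of the path climb from potential 0 to [N], each by at most one, hence each by
    exactly one. *)
Lemma path_dist j : j < size p -> d (nth x0 p j) = j.+1.
Proof.
have slowT := balanced_slow bT.
move=> ltj; apply/eqP; rewrite eqn_leq; apply/andP; split.
  elim: j ltj => [|j IHj] ltj; first exact: slowT arc_src.
  by apply: leq_trans (slowT _ _ (arc_mid ltj)) _; rewrite ltnS IHj // ltnW.
(* The lower bound goes backwards from t; [m] counts the positions left before the last one,
   [2 * l]. *)
have [m em] : exists m, j + m = 2 * l.
  by exists (2 * l - j); move: ltj; rewrite size_p; clear; lia.
elim: m j ltj em => [|m IHm] j ltj em.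
  have := slowT _ _ arc_snk; rewrite -em addn0 /= /N.
  by move: em; clear; lia.
have ltj1 : j.+1 < size p by move: em; rewrite size_p; clear; lia.
have := slowT _ _ (arc_mid ltj1); have := IHm j.+1 ltj1 _.
by rewrite /= addSnnS => /(_ em); clear; lia.
Qed.

Lemma path_alternates j : j < size p -> (nth x0 p j \in T) = odd j.
Proof.
elim: j => [_|j IHj ltj]; first by have /andP[/negPf] := arc_src.
have := arc_mid ltj => /= /orP[] /and3P[]; rewrite IHj ?(ltnW ltj) //.
  by move=> -> /negPf.
by move=> /negPf-> ->.
Qed.

Lemma in_path x : (x \in p) = (0 < d x < N) && (x == nth x0 p (d x).-1).
Proof.
apply/idP/idP=> [/(nthP x0)[j ltj <-]|/andP[dx /eqP->]].
  by rewrite path_dist // eqxx andbT /N; move: ltj; rewrite size_p; clear; lia.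
by apply: mem_nth; rewrite size_p; move: dx; rewrite /N; clear; lia.
Qed.

Let T' := augment T p.

Lemma in_augment x : (x \in T') = (x \in T) (+) (x \in p).
Proof. exact: augment_in path_alternates. Qed.

(** The path has one element at each distance strictly between 0 and [N]; it is gained at odd and
    lost at even distances. *)
Lemma balanced_augment : balanced T' i.+1.
Proof.
have [bo be bs bc] := bT.
split=> [j ltj oj|j ltj ej|x ex|x dx].
- have ltj1 : j.-1 < size p by
    rewrite size_p; move: ltj oj; rewrite /N; clear; lia.
  have j0 : 0 < j by case: j oj {ltj ltj1}.
  have dj : d (nth x0 p j.-1) = j by rewrite path_dist // prednK.
  have -> : T' :&: level d j = nth x0 p j.-1 |: (T :&: level d j).
    apply/setP=> x; rewrite !inE in_augment in_path.
    case: (d x =P j) => [->|ne]; last first.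
      by rewrite !andbF orbF; apply/esym/negP=> /eqP e; rewrite e in ne.
    rewrite j0 ltj !andbT /=; case: eqP => [->|_]; last by rewrite addbF.
    by rewrite path_alternates //; move: j0 oj; clear; lia.
  rewrite cardsU1 bo // inE path_alternates //.
  by rewrite (_ : odd j.-1 = false) //; move: j0 oj; clear; lia.
- have ltj1 : j.-1 < size p by
    rewrite size_p; move: ltj ej; rewrite /N; clear; lia.
  have j0 : 0 < j by case/andP: ltj.
  have dj : d (nth x0 p j.-1) = j by rewrite path_dist // prednK.
  have pT : nth x0 p j.-1 \in T.
    by rewrite path_alternates //; move: j0 ej; clear; lia.
  have -> : (S :\: T') :&: level d j =
      nth x0 p j.-1 |: ((S :\: T) :&: level d j).
    apply/setP=> x; rewrite !inE in_augment in_path.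
    case: (d x =P j) => [->|ne]; last first.
      by rewrite !andbF orbF; apply/esym/negP=> /eqP e; rewrite e in ne.
    rewrite ltj !andbT /=; case: eqP => [->|_]; last by rewrite addbF.
    by rewrite pT bs // dj.
  by rewrite cardsU1 be // !inE pT.
- rewrite in_augment; case xT: (x \in T) => /=; first by move=> _; apply: bs.
  rewrite in_path => /andP[ltx /eqP e]; move: xT; rewrite e path_alternates.
    by move: ltx ex; clear; lia.
  by rewrite size_p; move: ltx; rewrite /N; clear; lia.
- by move=> xS; rewrite in_augment in_path bc // dx ltnn andbF.
Qed.

(** A level of [g1] or [g2] meets [p] in two, one or no elements. This lemma and the next two
    identify the swap there with the exchange of an inner arc, the addition of an end arc, or [T]
    itself. *)
Lemma swap_pair g k a b : a \in T -> b \notin T ->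
    (forall x, (x \in p) && (g x == k) = (x == a) || (x == b)) ->
  level_swap g T T' k = b |: (T :\ a).
Proof.
move=> aT bT' pk; apply/setP=> x; have := pk x.
rewrite !inE in_augment; case: eqP => _ /=; rewrite ?andbF ?andbT ?orbF /=.
  move=> ->; case: eqP => [->|] /=; last first.
    by case: eqP => [->|]; rewrite ?(negPf bT') ?addbF.
  by rewrite aT; case: eqP aT bT' => // -> ->.
by move/esym/negbT; rewrite negb_or => /andP[-> /negPf->].
Qed.

Lemma swap_one g k b : b \notin T ->
    (forall x, (x \in p) && (g x == k) = (x == b)) ->
  level_swap g T T' k = b |: T.
Proof.
move=> bT' pk; apply/setP=> x; have := pk x.
rewrite !inE in_augment; case: eqP => _ /=; rewrite ?andbF ?andbT ?orbF /=.
  by move=> ->; case: eqP => [->|]; rewrite ?(negPf bT') ?addbF.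
by move/esym->.
Qed.

Lemma swap_none g k :
    (forall x, (x \in p) && (g x == k) = false) -> level_swap g T T' k = T.
Proof.
move=> pk; apply/setP=> x; have := pk x.
rewrite !inE in_augment; case: eqP => _ /=; rewrite ?andbF ?andbT ?orbF //=.
by move=> ->; rewrite addbF.
Qed.

Lemma eq_nth_path j x : j < size p ->
  (x == nth x0 p j) = (x \in p) && (d x == j.+1).
Proof.
move=> ltj; apply/eqP/andP=> [->|[xp /eqP dx]].
  by rewrite mem_nth // path_dist.
by move: xp; rewrite in_path dx => /andP[_ /eqP].
Qed.

Lemma path_dist_bounds x : x \in p -> 0 < d x < N.
Proof. by rewrite in_path => /andP[]. Qed.

Lemma arc_odd j : j.+1 < size p -> odd j ->
  nth x0 p j.+1 |: (T :\ nth x0 p j) \in indep M1.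
Proof.
move=> ltj oj; have /= := arc_mid ltj.
by rewrite !path_alternates ?(ltnW ltj) //= oj /= orbF.
Qed.

Lemma arc_even j : j.+1 < size p -> ~~ odd j ->
  nth x0 p j |: (T :\ nth x0 p j.+1) \in indep M2.
Proof.
move=> ltj oj; have /= := arc_mid ltj.
by rewrite !path_alternates ?(ltnW ltj) //= (negPf oj).
Qed.

Lemma indep_augment1 : T' \in indep M1.
Proof.
apply: indep_level_swap iT1 (balanced_spanning1 bT)
  (balanced_spanning1 balanced_augment) _ => k.
have [-> | k0] := posnP k.
  rewrite (@swap_one _ _ (nth x0 p 0)).
  - by have /andP[] := arc_src.
  - by rewrite path_alternates ?size_p.
  - move=> x; rewrite eq_nth_path ?size_p //; case xp: (x \in p) => //=.
    by have := path_dist_bounds xp; rewrite /g1; clear; lia.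
have [le|gt] := leqP k l; last first.
  rewrite swap_none // => x; case xp: (x \in p) => //=.
  by have := path_dist_bounds xp; move: gt; rewrite /g1 /N; clear; lia.
(* Positions count from 0, so distances [2k] and [2k+1] are found at positions [2k-1] and [2k],
   joined by an [M1] arc. *)
have ltk : (k.*2.-1).+1 < size p by rewrite size_p; move: k0 le; clear; lia.
have ok : odd k.*2.-1 by move: k0; clear; lia.
rewrite (@swap_pair _ _ (nth x0 p k.*2.-1) (nth x0 p (k.*2.-1).+1)).
- exact: arc_odd.
- by rewrite path_alternates ?(ltnW ltk).
- by rewrite path_alternates //= ok.
- move=> x; rewrite !eq_nth_path ?(ltnW ltk) //; case xp: (x \in p) => //=.
  by have := path_dist_bounds xp; move: k0; rewrite /g1; clear; lia.
Qed.

Lemma indep_augment2 : T' \in indep M2.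
Proof.
apply: indep_level_swap iT2 (balanced_spanning2 bT)
  (balanced_spanning2 balanced_augment) _ => k.
have [-> | k0] := posnP k.
  have lt2l : 2 * l < size p by rewrite size_p.
  rewrite (@swap_one _ _ (nth x0 p (2 * l))).
  - by have /andP[] := arc_snk.
  - by rewrite path_alternates // mul2n odd_double.
  - move=> x; rewrite eq_nth_path //; case xp: (x \in p) => //=.
    by have := path_dist_bounds xp; rewrite /g2 /N; clear; lia.
have [le|gt] := leqP k l; last first.
  rewrite swap_none // => x; case xp: (x \in p) => //=.
  by have := path_dist_bounds xp; move: gt; rewrite /g2 /N; clear; lia.
(* With [j = l - k], level [k] of [g2] consists of distances [2j+1] and [2j+2], at positions [2j]
   and [2j+1]. *)
have [j ej] : exists j, j + k = l by exists (l - k); rewrite subnK.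
have ltj : (j.*2).+1 < size p by rewrite size_p; move: k0 ej; clear; lia.
have oj : ~~ odd j.*2 by rewrite odd_double.
rewrite (@swap_pair _ _ (nth x0 p (j.*2).+1) (nth x0 p j.*2)).
- exact: arc_even.
- by rewrite path_alternates //= oj.
- by rewrite path_alternates ?(ltnW ltj).
- move=> x; rewrite !eq_nth_path ?(ltnW ltj) //; case xp: (x \in p) => //=.
  have := path_dist_bounds xp; move: ej k0; rewrite /g2 /N; clear; lia.
Qed.

End OnePath.

(** * From all the paths to exchanges in [S] *)

Lemma balanced_paths P : consecutive_shortest_paths M1 M2 l S P ->
  let T := foldl (@augment V) S P in
  [/\ T \in indep M1, T \in indep M2 & balanced T (size P)].
Proof.
elim/last_ind: P => [_|P p IHP] /=; first by split=> //; apply: balancedS.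
move=> consP; have [|iT1 iT2 bT] := IHP.
  move=> i lti; have := consP i; rewrite size_rcons ltnS => /(_ (ltnW lti)).
  by rewrite nth_rcons lti -cats1 takel_cat // ltnW.
have := consP (size P); rewrite size_rcons => /(_ (leqnn _)).
rewrite nth_rcons ltnn eqxx -cats1 take_size_cat // cats1 => -[szp stp].
have {}szp : size p = (2 * l).+1 by move: szp; rewrite /st_length; clear; lia.
(* The path has odd size, so it is nonempty and its head can serve as the default of [nth]. *)
case: p szp stp {consP} => [//|x0 p] szp stp.
rewrite foldl_rcons; split.
- exact: indep_augment1 x0 iT1 bT szp stp.
- exact: indep_augment2 x0 iT2 bT szp stp.
- exact: balanced_augment x0 bT szp stp.
Qed.

(** The set lies inside the swap of [T] into [S] at level [k] of [g1]: elements of [S] at distance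
    [2k] that are not removed belong to [T], and [S] has none at distance [2k+1]. *)
Lemma exchange_levels1 T w k : T \in indep M1 -> balanced T w ->
  (S :\: ((S :\: T) :&: level d k.*2)) :|: (T :&: level d k.*2.+1)
    \in indep M1.
Proof.
move=> iT bT; have spS := level_monotone_spanning iS1 monotoneS1.
have := level_swap_indep k iS1 iT spS (balanced_spanning1 bT).
apply: indepS; apply/subsetP=> x; rewrite !inE /g1.
case/orP=> [/andP[nx xS]|/andP[xT /eqP dx]].
  move: nx; rewrite xS !andbT negb_and negbK => /orP[-> /=|ne].
    exact: orNb.
  suff -> : (d x)./2 != k by [].
  by move: (d_in xS) ne; clear; lia.
rewrite xT dx; suff -> : (k.*2.+1)./2 = k by rewrite eqxx orbT.
by clear; lia.
Qed.

(** Same argument at level [l - k] of [g2], which consists of distances [2k+1] and [2k+2]. *)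
Lemma exchange_levels2 T w k : T \in indep M2 -> balanced T w -> k <= l ->
  (S :\: ((S :\: T) :&: level d k.*2.+2)) :|: (T :&: level d k.*2.+1)
    \in indep M2.
Proof.
move=> iT bT lek; have spS := level_monotone_spanning iS2 monotoneS2.
have := level_swap_indep (l - k) iS2 iT spS (balanced_spanning2 bT).
apply: indepS; apply/subsetP=> x; rewrite !inE /g2.
case/orP=> [/andP[nx xS]|/andP[xT /eqP dx]].
  move: nx; rewrite xS !andbT negb_and negbK => /orP[-> /=|ne].
    exact: orNb.
  suff -> : (N - d x)./2 != l - k by [].
  by move: (d_in xS) (d_le x) ne lek; rewrite /N; clear; lia.
rewrite xT dx; suff -> : (N - k.*2.+1)./2 = l - k by rewrite eqxx orbT.
by move: lek; rewrite /N; clear; lia.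
Qed.

End Potential.

(** * Construction of the augmenting set *)

Theorem theorem6p9 (V : finType) (M1 M2 : matroid V) (S : {set V}) (l : nat)
    (P : seq (seq V)) :
  S \in indep M1 -> S \in indep M2 ->
  dist_is (exchange_graph M1 M2 S) src snk (2 * l.+1) ->
  consecutive_shortest_paths M1 M2 l S P ->
  {Pi : set_chain V l | is_augmenting_set M1 M2 S (size P) Pi}.
Proof.
move=> iS1 iS2 dist_t consP.
pose N := 2 * l.+1; pose e := exchange_graph M1 M2 S.
pose d (v : V) := capped_dist e N src (inl v).
have d_walk v : d v < N -> has_walk e src (inl v) (d v).
  by case/capped_distP/andP.
have d_gt0 v : 0 < d v.
  rewrite lt0n; apply/eqP=> d0; have := d_walk v; rewrite d0 => /(_ isT).
  by case/existsP=> p; rewrite tuple0.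
have d_le v : d v <= N by apply: capped_dist_le.
have d_in v : v \in S -> ~~ odd (d v).
  move=> vS; have [lt|ge] := ltnP (d v) N.
    by rewrite -(exchange_walk_parity (d_walk v lt)).
  have -> : d v = N by apply/eqP; rewrite eqn_leq d_le.
  by rewrite /N mul2n odd_double.
have slowS : slow M1 M2 l d S.
  (* The potential gives t the value [N], and this is its true distance by hypothesis. *)
  have pot x : capped_dist e N src x = potential l d x.
    case: x => [v|[]] //=; first exact: capped_dist_cap.
    apply/eqP; rewrite -leqn0; apply: capped_dist_le_walk.
    by apply/existsP; exists [tuple]; rewrite /= eqxx.
  by move=> x y exy; rewrite -!pot; apply: capped_dist_step.
have /= := balanced_paths iS1 iS2 d_gt0 d_le d_in slowS consP.
set T := foldl _ _ _ => -[iT1 iT2 bT].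
have ex1 := exchange_levels1 iS1 d_le d_in slowS _ iT1 bT.
have ex2 := exchange_levels2 iS2 d_gt0 d_le d_in slowS iT2 bT.
(* Below the cap, [d] is the exact distance that [layer] asks for. *)
have subL (X : {set V}) j : j < N -> X :&: level d j \subset layer M1 M2 S j.
  move=> ltj; apply/subsetP=> x /setIP[_]; rewrite !inE => /eqP dx.
  have := @capped_distP _ e N src (inl x).
  by rewrite -/(d x) dx; apply.
pose B := [tuple T :&: level d k.*2.+1 | k < l.+1].
pose A := [tuple (S :\: T) :&: level d k.*2.+2 | k < l].
exists (B, A); apply/and5P; split; last (apply/and4P; split).
- apply/forallP=> k; rewrite tnth_mktuple mul2n doubleS.
  by apply: subL; have := ltn_ord k; rewrite /N; clear; lia.
- apply/forallP=> k; rewrite tnth_mktuple mul2n doubleS subn1.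
  by apply: subL; have := ltn_ord k; rewrite /N; clear; lia.
- apply/forallP=> k; rewrite tnth_mktuple (bal_even bT) //=.
    by have := ltn_ord k; clear; lia.
  by rewrite negbK odd_double.
- apply/forallP=> k; rewrite tnth_mktuple (bal_odd bT) //=.
    by have := ltn_ord k; clear; lia.
  by rewrite odd_double.
- rewrite tnth_mktuple; have := ex1 0.
  (* No element is at distance 0, so nothing is removed and condition (c) remains. *)
  suff -> : (S :\: T) :&: level d 0.*2 = set0 by rewrite setD0.
  by apply/setP=> x; rewrite !inE eqn0Ngt d_gt0 andbF.
- rewrite tnth_mktuple; have := ex2 l (leqnn l).
  (* Here [l.*2.+2] is [N], where [T] keeps every element of [S]; this leaves condition (d). *)
  suff -> : (S :\: T) :&: level d l.*2.+2 = set0 by rewrite setD0.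
  apply/setP=> x; rewrite !inE -doubleS -mul2n.
  case: eqP => [/(bal_cap bT) xST|_]; rewrite ?andbF ?andbT //.
  by apply/andP=> -[/negP xT /xST].
- apply/forallP=> k; rewrite !tnth_mktuple lift0 -doubleS.
  exact: ex1.
- apply/forallP=> k; rewrite !tnth_mktuple.
  by apply: ex2; apply: ltnW.
Qed.
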